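(* $I\Sigma_1$ is conservative over $\mathbb T$: for every sequent $\varphi(\bar x)\vdash_{\bar x}\psi(\bar x)$ in the language of $\mathbb T$, if it is provable in $I\Sigma_1$ then it is provable in $\mathbb T$.
   Context: Coherent logic: formulas built from atomic formulas (including equalities) using only $\top,\bot,\wedge,\vee,\exists$; sequents $\varphi\vdash_{\bar x}\psi$ derived with the standard coherent deduction system. PrimRec is the set of primitive recursive function descriptions generated from $\mathsf z$ (constant $0$), $\mathsf s$ (successor), projections $\pi^n_k$, composition $\mathrm{Cn}[\mathsf h,\mathsf g_1,\dots,\mathsf g_n]$ and primitive recursion $\mathrm{Pr}[\mathsf g,\mathsf h]$. The coherent arithmetic $\mathbb T$ has a constant $\mathsf 0$, a function symbol for each element of PrimRec, and a binary predicate $<$, with axioms: $\mathsf zx=\mathsf 0$; $\pi^n_k(x_1,\dots,x_n)=x_k$; $\mathsf sx=\mathsf 0\vdash\bot$; $\mathsf sx=\mathsf sy\vdash x=y$; the defining equations of each composition and primitive recursion symbol; $x<y\dashv\vdash\exists z(x+\mathsf sz=y)$ with $+$ the PrimRec addition. Formulas may also use bounded universal quantifiers $\forall z<t\,\varphi$ ($t$ not containing $z$) with the double rule $\psi\vdash\forall z<t\,\varphi$ iff $\psi\wedge z<t\vdash\varphi$ ($z$ not free in $\psi$), and $\mathbb T$ has the induction rules (IndR): from $\psi(\bar x)\vdash\varphi(\bar x,\mathsf 0)$ and $\psi(\bar x)\wedge\varphi(\bar x,y)\vdash\varphi(\bar x,\mathsf sy)$ infer $\psi(\bar x)\vdash_{\bar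 x,y}\varphi(\bar x,y)$; (IndL): from $\psi(\bar x,\mathsf 0)\vdash\varphi(\bar x)$ and $\psi(\bar x,\mathsf sy)\vdash\varphi(\bar x)\vee\psi(\bar x,y)$ infer $\psi(\bar x,y)\vdash_{\bar x,y}\varphi(\bar x)$. $I\Sigma_1$ is the classical first-order theory of arithmetic with the basic axioms for $0$, successor, addition, multiplication, and the induction schema restricted to $\Sigma_1$-formulas; here it is taken in its definitional extension by all function symbols of PrimRec with their defining axioms and $<$ with its defining axiom, so that every $\mathbb T$-formula is an $I\Sigma_1$-formula (reading $\forall z<t\,\varphi$ as $\forall z(z<t\to\varphi)$), and a sequent $\varphi\vdash_{\bar x}\psi$ is provable in $I\Sigma_1$ when $I\Sigma_1\vdash\forall\bar x(\varphi\to\psi)$. *)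

(* Defs.v *)
From mathcomp Require Import all_boot.

Set Implicit Arguments.
Unset Strict Implicit.
Unset Printing Implicit Defensive.

(* A finite tuple of length k is a function on 'I_k. *)

Definition scons (T : Type) (n : nat) (x : T) (xs : 'I_n -> T) : 'I_n.+1 -> T :=
  fun i => if unlift ord0 i is Some j then xs j else x.

Definition snoc (T : Type) (n : nat) (xs : 'I_n -> T) (x : T) : 'I_n.+1 -> T :=
  fun i => if unlift ord_max i is Some j then xs j else x.

(* The index is the arity.  Since z is unary, primrec 0 is empty, so PrCn with
   n = 0 and PrPr with n = 0 produce nothing. *)
Inductive primrec : nat -> Type :=
| PrZ : primrec 1
| PrS : primrec 1
| PrProj (n : nat) (k : 'I_n) : primrec n
| PrCn (n m : nat) (h : primrec n) (g : 'I_n -> primrec m) : primrec m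
| PrPr (n : nat) (g : primrec n) (h : primrec n.+2) : primrec n.+1.

(* x + 0 = x and x + s y = s (x + y) *)
Definition PrAdd : primrec 2 :=
  PrPr (PrProj (ord0 : 'I_1)) (PrCn PrS (fun _ => PrProj (ord_max : 'I_3))).

(* x * 0 = 0 and x * s y = x * y + x *)
Definition PrMul : primrec 2 :=
  PrPr PrZ (PrCn PrAdd (tnth [tuple PrProj (ord_max : 'I_3);
                                    PrProj (ord0 : 'I_3)])).

(* Well-scoped de Bruijn syntax: the index n of a term or a formula is the
   length of its context of free variables; a quantifier binds variable ord0 of
   the extended context and shifts the others by lift ord0. *)

Inductive tm (n : nat) : Type :=
| Var (i : 'I_n)
| Zero
| App (k : nat) (f : primrec k) (ts : 'I_k -> tm n).

Arguments Zero {n}.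

Fixpoint tsubst (n m : nat) (sigma : 'I_n -> tm m) (t : tm n) : tm m :=
  match t with
  | Var i => sigma i
  | Zero => Zero
  | App k f ts => App f (fun i => tsubst sigma (ts i))
  end.

Definition shift (n : nat) : 'I_n -> tm n.+1 := fun i => Var (lift ord0 i).

Definition up (n m : nat) (sigma : 'I_n -> tm m) : 'I_n.+1 -> tm m.+1 :=
  scons (Var ord0) (fun i => tsubst (@shift m) (sigma i)).

Definition inst (n : nat) (t : tm n) : 'I_n.+1 -> tm n := scons t (@Var n).

Definition Succ (n : nat) (t : tm n) : tm n := App PrS (fun _ => t).
Definition Add (n : nat) (s t : tm n) : tm n := App PrAdd (tnth [tuple s; t]).
Definition Mul (n : nat) (s t : tm n) : tm n := App PrMul (tnth [tuple s; t]).

(* substitutes s y for y = Var ord0 and fixes the other variables *)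
Definition succ_inst (n : nat) : 'I_n.+1 -> tm n.+1 :=
  scons (Succ (Var ord0)) (@shift n).

(* def_eqn s t: the equation s = t, in its context of variables, is one of the
   defining equations of the function symbols. *)
Inductive def_eqn : forall n : nat, tm n -> tm n -> Prop :=
| DefZ : def_eqn (App PrZ (@Var 1)) Zero
| DefProj (n : nat) (k : 'I_n) : def_eqn (App (PrProj k) (@Var n)) (Var k)
| DefCn (n m : nat) (h : primrec n) (g : 'I_n -> primrec m) :
    def_eqn (App (PrCn h g) (@Var m)) (App h (fun i => App (g i) (@Var m)))
| DefPr0 (n : nat) (g : primrec n) (h : primrec n.+2) :
    def_eqn (App (PrPr g h) (snoc (@Var n) Zero)) (App g (@Var n))
| DefPrS (n : nat) (g : primrec n) (h : primrec n.+2) :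
    let xs := @shift n in let y := Var (ord0 : 'I_n.+1) in
    def_eqn (App (PrPr g h) (snoc xs (Succ y)))
            (App h (snoc (snoc xs y) (App (PrPr g h) (snoc xs y)))).

(** Coherent arithmetic *)

(* CBAll t phi is "forall z < t, phi"; t lives in the outer context, hence does
   not contain z. *)
Inductive cform (n : nat) : Type :=
| CEq (s t : tm n)
| CLt (s t : tm n)
| CTop
| CBot
| CAnd (phi psi : cform n)
| COr (phi psi : cform n)
| CEx (phi : cform n.+1)
| CBAll (t : tm n) (phi : cform n.+1).

Arguments CTop {n}.
Arguments CBot {n}.

Fixpoint csubst (n m : nat) (sigma : 'I_n -> tm m) (phi : cform n) : cform m :=
  match phi with
  | CEq s t => CEq (tsubst sigma s) (tsubst sigma t)
  | CLt s t => CLt (tsubst sigma s) (tsubst sigma t)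
  | CTop => CTop
  | CBot => CBot
  | CAnd a b => CAnd (csubst sigma a) (csubst sigma b)
  | COr a b => COr (csubst sigma a) (csubst sigma b)
  | CEx a => CEx (csubst (up sigma) a)
  | CBAll t a => CBAll (tsubst sigma t) (csubst (up sigma) a)
  end.

Definition cshift (n : nat) (phi : cform n) : cform n.+1 := csubst (@shift n) phi.

Inductive T_axiom : forall n : nat, cform n -> cform n -> Prop :=
| T_def (n : nat) (s t : tm n) : def_eqn s t -> T_axiom CTop (CEq s t)
| T_succ_neq0 : T_axiom (CEq (Succ (Var (ord0 : 'I_1))) Zero) CBot
| T_succ_inj :
    let x := Var (ord0 : 'I_2) in let y := Var (ord_max : 'I_2) in
    T_axiom (CEq (Succ x) (Succ y)) (CEq x y)
| T_lt_ex :
    let x := Var (ord0 : 'I_2) in let y := Var (ord_max : 'I_2) in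
    T_axiom (CLt x y)
      (CEx (CEq (Add (tsubst (@shift 2) x) (Succ (Var ord0)))
                (tsubst (@shift 2) y)))
| T_ex_lt :
    let x := Var (ord0 : 'I_2) in let y := Var (ord_max : 'I_2) in
    T_axiom
      (CEx (CEq (Add (tsubst (@shift 2) x) (Succ (Var ord0)))
                (tsubst (@shift 2) y)))
      (CLt x y).

(* T_proves phi psi, for phi psi : cform n, is derivability of the sequent
   phi |- psi in a context of n variables. *)
Inductive T_proves : forall n : nat, cform n -> cform n -> Prop :=
| TP_ax n (phi psi : cform n) : T_axiom phi psi -> T_proves phi psi
| TP_id n (phi : cform n) : T_proves phi phi
| TP_subst n m (sigma : 'I_n -> tm m) (phi psi : cform n) :
    T_proves phi psi -> T_proves (csubst sigma phi) (csubst sigma psi)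
| TP_cut n (phi psi chi : cform n) :
    T_proves phi psi -> T_proves psi chi -> T_proves phi chi
| TP_refl n (t : tm n) : T_proves CTop (CEq t t)
| TP_leibniz n (s t : tm n) (phi : cform n.+1) :
    T_proves (CAnd (CEq s t) (csubst (inst s) phi)) (csubst (inst t) phi)
| TP_top n (phi : cform n) : T_proves phi CTop
| TP_andl n (phi psi : cform n) : T_proves (CAnd phi psi) phi
| TP_andr n (phi psi : cform n) : T_proves (CAnd phi psi) psi
| TP_and n (phi psi chi : cform n) :
    T_proves phi psi -> T_proves phi chi -> T_proves phi (CAnd psi chi)
| TP_bot n (phi : cform n) : T_proves CBot phi
| TP_orl n (phi psi : cform n) : T_proves phi (COr phi psi)
| TP_orr n (phi psi : cform n) : T_proves psi (COr phi psi)
| TP_or n (phi psi chi : cform n) :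
    T_proves phi chi -> T_proves psi chi -> T_proves (COr phi psi) chi
| TP_ex_down n (phi : cform n.+1) (psi : cform n) :
    T_proves phi (cshift psi) -> T_proves (CEx phi) psi
| TP_ex_up n (phi : cform n.+1) (psi : cform n) :
    T_proves (CEx phi) psi -> T_proves phi (cshift psi)
| TP_distr n (phi psi chi : cform n) :
    T_proves (CAnd phi (COr psi chi)) (COr (CAnd phi psi) (CAnd phi chi))
| TP_frobenius n (phi : cform n) (psi : cform n.+1) :
    T_proves (CAnd phi (CEx psi)) (CEx (CAnd (cshift phi) psi))
| TP_ball_down n (t : tm n) (psi : cform n) (phi : cform n.+1) :
    T_proves (CAnd (cshift psi) (CLt (Var ord0) (tsubst (@shift n) t))) phi ->
    T_proves psi (CBAll t phi)
| TP_ball_up n (t : tm n) (psi : cform n) (phi : cform n.+1) :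
    T_proves psi (CBAll t phi) ->
    T_proves (CAnd (cshift psi) (CLt (Var ord0) (tsubst (@shift n) t))) phi
| TP_indR n (psi : cform n) (phi : cform n.+1) :
    T_proves psi (csubst (inst Zero) phi) ->
    T_proves (CAnd (cshift psi) phi) (csubst (@succ_inst n) phi) ->
    T_proves (cshift psi) phi
| TP_indL n (phi : cform n) (psi : cform n.+1) :
    T_proves (csubst (inst Zero) psi) phi ->
    T_proves (csubst (@succ_inst n) psi) (COr (cshift phi) psi) ->
    T_proves psi (cshift phi).

(** Classical first-order logic and ISigma1 *)

Inductive fform (n : nat) : Type :=
| FEq (s t : tm n)
| FLt (s t : tm n)
| FTop
| FBot
| FAnd (phi psi : fform n)
| FOr (phi psi : fform n)
| FImp (phi psi : fform n)
| FEx (phi : fform n.+1)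
| FAll (phi : fform n.+1).

Arguments FTop {n}.
Arguments FBot {n}.

Fixpoint fsubst (n m : nat) (sigma : 'I_n -> tm m) (phi : fform n) : fform m :=
  match phi with
  | FEq s t => FEq (tsubst sigma s) (tsubst sigma t)
  | FLt s t => FLt (tsubst sigma s) (tsubst sigma t)
  | FTop => FTop
  | FBot => FBot
  | FAnd a b => FAnd (fsubst sigma a) (fsubst sigma b)
  | FOr a b => FOr (fsubst sigma a) (fsubst sigma b)
  | FImp a b => FImp (fsubst sigma a) (fsubst sigma b)
  | FEx a => FEx (fsubst (up sigma) a)
  | FAll a => FAll (fsubst (up sigma) a)
  end.

Definition fshift (n : nat) (phi : fform n) : fform n.+1 := fsubst (@shift n) phi.

Definition FNot (n : nat) (phi : fform n) : fform n := FImp phi FBot.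
Definition FIff (n : nat) (phi psi : fform n) : fform n :=
  FAnd (FImp phi psi) (FImp psi phi).

Definition FBAll (n : nat) (t : tm n) (phi : fform n.+1) : fform n :=
  FAll (FImp (FLt (Var ord0) (tsubst (@shift n) t)) phi).
Definition FBEx (n : nat) (t : tm n) (phi : fform n.+1) : fform n :=
  FEx (FAnd (FLt (Var ord0) (tsubst (@shift n) t)) phi).

Fixpoint univ_closure (n : nat) : fform n -> fform 0 :=
  match n with
  | 0 => fun phi => phi
  | n'.+1 => fun phi => univ_closure (FAll phi)
  end.

Fixpoint embed (n : nat) (phi : cform n) : fform n :=
  match phi with
  | CEq s t => FEq s t
  | CLt s t => FLt s t
  | CTop => FTop
  | CBot => FBot
  | CAnd a b => FAnd (embed a) (embed b)
  | COr a b => FOr (embed a) (embed b)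
  | CEx a => FEx (embed a)
  | CBAll t a => FBAll t (embed a)
  end.

(* Classical natural deduction with equality from a set Ax of sentences;
   Gamma is the list of open assumptions. *)
Inductive fol_proves (Ax : fform 0 -> Prop) :
    forall n : nat, seq (fform n) -> fform n -> Prop :=
| FP_ax n (Gamma : seq (fform n)) (phi : fform 0) :
    Ax phi ->
    fol_proves Ax Gamma (fsubst (fun i => Var (widen_ord (leq0n n) i)) phi)
| FP_hyp n (Gamma1 Gamma2 : seq (fform n)) phi :
    fol_proves Ax (Gamma1 ++ phi :: Gamma2) phi
| FP_topI n (Gamma : seq (fform n)) : fol_proves Ax Gamma FTop
| FP_raa n (Gamma : seq (fform n)) phi :
    fol_proves Ax (FNot phi :: Gamma) FBot -> fol_proves Ax Gamma phi
| FP_andI n (Gamma : seq (fform n)) phi psi :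
    fol_proves Ax Gamma phi -> fol_proves Ax Gamma psi ->
    fol_proves Ax Gamma (FAnd phi psi)
| FP_andEl n (Gamma : seq (fform n)) phi psi :
    fol_proves Ax Gamma (FAnd phi psi) -> fol_proves Ax Gamma phi
| FP_andEr n (Gamma : seq (fform n)) phi psi :
    fol_proves Ax Gamma (FAnd phi psi) -> fol_proves Ax Gamma psi
| FP_orIl n (Gamma : seq (fform n)) phi psi :
    fol_proves Ax Gamma phi -> fol_proves Ax Gamma (FOr phi psi)
| FP_orIr n (Gamma : seq (fform n)) phi psi :
    fol_proves Ax Gamma psi -> fol_proves Ax Gamma (FOr phi psi)
| FP_orE n (Gamma : seq (fform n)) phi psi chi :
    fol_proves Ax Gamma (FOr phi psi) ->
    fol_proves Ax (phi :: Gamma) chi -> fol_proves Ax (psi :: Gamma) chi ->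
    fol_proves Ax Gamma chi
| FP_impI n (Gamma : seq (fform n)) phi psi :
    fol_proves Ax (phi :: Gamma) psi -> fol_proves Ax Gamma (FImp phi psi)
| FP_impE n (Gamma : seq (fform n)) phi psi :
    fol_proves Ax Gamma (FImp phi psi) -> fol_proves Ax Gamma phi ->
    fol_proves Ax Gamma psi
| FP_allI n (Gamma : seq (fform n)) (phi : fform n.+1) :
    fol_proves Ax (map (@fshift n) Gamma) phi -> fol_proves Ax Gamma (FAll phi)
| FP_allE n (Gamma : seq (fform n)) (phi : fform n.+1) (t : tm n) :
    fol_proves Ax Gamma (FAll phi) -> fol_proves Ax Gamma (fsubst (inst t) phi)
| FP_exI n (Gamma : seq (fform n)) (phi : fform n.+1) (t : tm n) :
    fol_proves Ax Gamma (fsubst (inst t) phi) -> fol_proves Ax Gamma (FEx phi)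
| FP_exE n (Gamma : seq (fform n)) (phi : fform n.+1) (psi : fform n) :
    fol_proves Ax Gamma (FEx phi) ->
    fol_proves Ax (phi :: map (@fshift n) Gamma) (fshift psi) ->
    fol_proves Ax Gamma psi
| FP_eqI n (Gamma : seq (fform n)) (t : tm n) : fol_proves Ax Gamma (FEq t t)
| FP_eqE n (Gamma : seq (fform n)) (s t : tm n) (phi : fform n.+1) :
    fol_proves Ax Gamma (FEq s t) -> fol_proves Ax Gamma (fsubst (inst s) phi) ->
    fol_proves Ax Gamma (fsubst (inst t) phi).

Inductive delta0 : forall n : nat, fform n -> Prop :=
| D0_eq n (s t : tm n) : delta0 (FEq s t)
| D0_lt n (s t : tm n) : delta0 (FLt s t)
| D0_top n : delta0 (@FTop n)
| D0_bot n : delta0 (@FBot n)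
| D0_and n (phi psi : fform n) : delta0 phi -> delta0 psi -> delta0 (FAnd phi psi)
| D0_or n (phi psi : fform n) : delta0 phi -> delta0 psi -> delta0 (FOr phi psi)
| D0_imp n (phi psi : fform n) : delta0 phi -> delta0 psi -> delta0 (FImp phi psi)
| D0_ball n (t : tm n) (phi : fform n.+1) : delta0 phi -> delta0 (FBAll t phi)
| D0_bex n (t : tm n) (phi : fform n.+1) : delta0 phi -> delta0 (FBEx t phi).

Inductive sigma1 : forall n : nat, fform n -> Prop :=
| S1_delta0 n (phi : fform n) : delta0 phi -> sigma1 phi
| S1_ex n (phi : fform n.+1) : sigma1 phi -> sigma1 (FEx phi).

(* ISigma1 over the expanded language.  The induction schema ranges over the
   Sigma1 formulas of the expanded language: in the definitional extension
   these are provably equivalent to Sigma1 formulas in 0, s, +, *, whereas the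
   recursion equations without induction for formulas containing the new
   symbols would not determine these symbols. *)
Inductive ISigma1 : fform 0 -> Prop :=
| IS_succ_neq0 :
    ISigma1 (univ_closure (FNot (FEq (Succ (Var (ord0 : 'I_1))) Zero)))
| IS_succ_inj :
    let x := Var (ord0 : 'I_2) in let y := Var (ord_max : 'I_2) in
    ISigma1 (univ_closure (FImp (FEq (Succ x) (Succ y)) (FEq x y)))
| IS_add0 :
    let x := Var (ord0 : 'I_1) in
    ISigma1 (univ_closure (FEq (Add x Zero) x))
| IS_addS :
    let x := Var (ord0 : 'I_2) in let y := Var (ord_max : 'I_2) in
    ISigma1 (univ_closure (FEq (Add x (Succ y)) (Succ (Add x y))))
| IS_mul0 :
    let x := Var (ord0 : 'I_1) in
    ISigma1 (univ_closure (FEq (Mul x Zero) Zero))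
| IS_mulS :
    let x := Var (ord0 : 'I_2) in let y := Var (ord_max : 'I_2) in
    ISigma1 (univ_closure (FEq (Mul x (Succ y)) (Add (Mul x y) x)))
| IS_def n (s t : tm n) : def_eqn s t -> ISigma1 (univ_closure (FEq s t))
| IS_lt :
    let x := Var (ord0 : 'I_2) in let y := Var (ord_max : 'I_2) in
    ISigma1 (univ_closure (FIff (FLt x y)
      (FEx (FEq (Add (tsubst (@shift 2) x) (Succ (Var ord0)))
                (tsubst (@shift 2) y)))))
| IS_ind n (phi : fform n.+1) :
    sigma1 phi ->
    ISigma1 (univ_closure
      (FImp (FAnd (fsubst (inst Zero) phi)
                  (FAll (FImp phi (fsubst (@succ_inst n) phi))))
            (FAll phi))).

Definition ISigma1_proves (n : nat) (phi psi : cform n) : Prop :=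
  fol_proves ISigma1 [::] (univ_closure (FImp (embed phi) (embed psi))).

(* Main.v *)
(** A forcing (negative translation) argument.  A condition is a pair (G, D) of
    coherent formulas, and it forces an atom A when T proves [G |- A \/ D];
    conditions are extended by substituting terms, strengthening G and weakening
    D.  Implication and universal quantification are interpreted as in Kripke
    models, disjunction and existence through double negation, so that classical
    logic is sound.  Every coherent formula A, like an atom, is forced exactly
    when [G |- A \/ D]; for bounded universal quantifiers this needs
    [forall z < t, A \/ D |- (forall z < t, A) \/ D], which is proved in T by
    induction.  As T decides atoms, every Sigma1 formula is forced like some
    coherent one, and then IndR with the induction formula [A \/ D] shows that
    the Sigma1 induction axioms are forced.  A sequent whose implication is
    forced at the condition (top, bot) is derivable. *)

From mathcomp Require Import all_boot.
From Stdlib Require Import FunctionalExtensionality PropExtensionality.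
From Stdlib Require List.
Require Import Defs.

Set Implicit Arguments.
Unset Strict Implicit.
Unset Printing Implicit Defensive.

Local Notation "phi |-- psi" := (T_proves phi psi) (at level 70, psi at next level).

(** * Substitutions *)

Definition tcomp k n m (s : 'I_k -> tm n) (r : 'I_n -> tm m) : 'I_k -> tm m :=
  fun i => tsubst r (s i).

Local Notation "s >> r" := (tcomp s r) (at level 56, left associativity).

Lemma scons0 T n (x : T) (xs : 'I_n -> T) : scons x xs ord0 = x.
Proof. by rewrite /scons unlift_none. Qed.

Lemma scons_lift T n (x : T) (xs : 'I_n -> T) i : scons x xs (lift ord0 i) = xs i.
Proof. by rewrite /scons liftK. Qed.

Lemma eq_from_scons T n (f g : 'I_n.+1 -> T) :
  f ord0 = g ord0 -> (forall i, f (lift ord0 i) = g (lift ord0 i)) -> f = g.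
Proof.
move=> eq0 eq_lift; apply: functional_extensionality => i.
by case: (unliftP ord0 i) => [j|] ->.
Qed.

Lemma snoc_max T n (xs : 'I_n -> T) x : snoc xs x ord_max = x.
Proof. by rewrite /snoc unlift_none. Qed.

Lemma snoc_lift T n (xs : 'I_n -> T) x i : snoc xs x (lift ord_max i) = xs i.
Proof. by rewrite /snoc liftK. Qed.

Lemma snoc_tuple2 T (xs : 'I_1 -> T) x : snoc xs x = tnth [tuple xs ord0; x].
Proof.
apply: functional_extensionality => i; case: (unliftP ord_max i) => [j|] ->.
  by rewrite snoc_lift (ord1 j).
by rewrite snoc_max.
Qed.

Lemma tsubst_tcomp k n m (s : 'I_k -> tm n) (r : 'I_n -> tm m) t :
  tsubst r (tsubst s t) = tsubst (s >> r) t.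
Proof.
elim: t => //= j f ts IH; congr App.
by apply: functional_extensionality => i; apply: IH.
Qed.

Lemma tsubst_Var n (t : tm n) : tsubst (@Var n) t = t.
Proof.
elim: t => //= j f ts IH; congr App.
by apply: functional_extensionality => i; apply: IH.
Qed.

Lemma tcompA k n m l (s : 'I_k -> tm n) (r : 'I_n -> tm m) (u : 'I_m -> tm l) :
  s >> r >> u = s >> (r >> u).
Proof. by apply: functional_extensionality => i; rewrite /tcomp tsubst_tcomp. Qed.

Lemma tcomp_Var_l n m (s : 'I_n -> tm m) : @Var n >> s = s.
Proof. exact: functional_extensionality. Qed.

Lemma tcomp_Var_r n m (s : 'I_n -> tm m) : s >> @Var m = s.
Proof. by apply: functional_extensionality => i; apply: tsubst_Var. Qed.

Lemma tcomp_scons k n m t (s : 'I_k -> tm n) (r : 'I_n -> tm m) :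
  scons t s >> r = scons (tsubst r t) (s >> r).
Proof. by apply: eq_from_scons => [|i]; rewrite /tcomp ?scons0 ?scons_lift. Qed.

Lemma tcomp_snoc k n m (s : 'I_k -> tm n) t (r : 'I_n -> tm m) :
  snoc s t >> r = snoc (s >> r) (tsubst r t).
Proof.
by apply: functional_extensionality => i; rewrite /tcomp /snoc; case: unlift.
Qed.

Lemma tcomp_tuple2 n m (s : 'I_n -> tm m) a b :
  tnth [tuple a; b] >> s = tnth [tuple tsubst s a; tsubst s b].
Proof. by apply: functional_extensionality => -[[|[|i]] //= ?]. Qed.

Lemma tcomp_shift n m t (s : 'I_n -> tm m) : @shift n >> scons t s = s.
Proof. by apply: functional_extensionality => i; rewrite /tcomp /= scons_lift. Qed.

Lemma scons_Var n : scons (Var ord0) (@shift n) = @Var n.+1.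
Proof. by apply: eq_from_scons => [|i]; rewrite ?scons0 ?scons_lift. Qed.

Lemma scons_eta n m (s : 'I_n.+1 -> tm m) : scons (s ord0) (@shift n >> s) = s.
Proof. by apply: eq_from_scons => [|i]; rewrite ?scons0 ?scons_lift. Qed.

Lemma upE n m (s : 'I_n -> tm m) : up s = scons (Var ord0) (s >> @shift m).
Proof. by []. Qed.

Lemma up_tcomp_scons k n m (s : 'I_k -> tm n) t (r : 'I_n -> tm m) :
  up s >> scons t r = scons t (s >> r).
Proof. by rewrite upE tcomp_scons /= scons0 tcompA tcomp_shift. Qed.

Lemma up_Var n : up (@Var n) = @Var n.+1.
Proof. by rewrite upE tcomp_Var_l scons_Var. Qed.

Lemma up_tcomp k n m (s : 'I_k -> tm n) (r : 'I_n -> tm m) :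
  up s >> up r = up (s >> r).
Proof. by rewrite (upE r) up_tcomp_scons upE tcompA. Qed.

Lemma tsubst_VarE n m (s : 'I_n -> tm m) i : tsubst s (Var i) = s i.
Proof. by []. Qed.

Lemma tsubst_Succ n m (s : 'I_n -> tm m) t : tsubst s (Succ t) = Succ (tsubst s t).
Proof. by []. Qed.

Lemma tsubst_Add n m (s : 'I_n -> tm m) a b :
  tsubst s (Add a b) = Add (tsubst s a) (tsubst s b).
Proof. by rewrite /Add -tcomp_tuple2. Qed.

Lemma csubst_tcomp k n m (s : 'I_k -> tm n) (r : 'I_n -> tm m) A :
  csubst r (csubst s A) = csubst (s >> r) A.
Proof.
elim: A n m s r => {k} //=; try by move=> k A IA B IB n m s r; rewrite IA IB.
- by move=> k a b n m s r; rewrite !tsubst_tcomp.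
- by move=> k a b n m s r; rewrite !tsubst_tcomp.
- by move=> k A IA n m s r; rewrite IA up_tcomp.
- by move=> k t A IA n m s r; rewrite IA up_tcomp tsubst_tcomp.
Qed.

Lemma csubst_Var n (A : cform n) : csubst (@Var n) A = A.
Proof.
elim: A => {n} //=; try by move=> n A -> B ->.
- by move=> n a b; rewrite !tsubst_Var.
- by move=> n a b; rewrite !tsubst_Var.
- by move=> n A IA; rewrite up_Var IA.
- by move=> n t A IA; rewrite up_Var IA tsubst_Var.
Qed.

Definition CLe n (a b : tm n) : cform n := COr (CLt a b) (CEq a b).

Definition substE := (csubst_tcomp, tsubst_tcomp, tcomp_scons, tcompA, tcomp_shift,
  tcomp_Var_l, tcomp_Var_r, csubst_Var, tsubst_Var, scons0, scons_lift, scons_Var,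
  tsubst_VarE, tsubst_Succ, tsubst_Add).

Ltac simpl_subst :=
  rewrite /cshift /succ_inst /inst /CLe; cbn [csubst]; rewrite ?upE ?substE.

Lemma inst_tcomp n m (s : 'I_n -> tm m) t :
  inst t >> s = up s >> inst (tsubst s t).
Proof. by simpl_subst. Qed.

(** * Derived rules of coherent logic *)

Section CoherentRules.
Variable n : nat.
Implicit Types (G A B C : cform n) (s t u : tm n).

Lemma weaken G A B : G |-- A -> CAnd G B |-- A.
Proof. exact: TP_cut (TP_andl _ _). Qed.

Lemma bot_elim G A : G |-- CBot -> G |-- A.
Proof. by move/TP_cut; apply; apply: TP_bot. Qed.

Lemma or_intro_l G A B : G |-- A -> G |-- COr A B.
Proof. by move/TP_cut; apply; apply: TP_orl. Qed.

Lemma or_intro_r G A B : G |-- B -> G |-- COr A B.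
Proof. by move/TP_cut; apply; apply: TP_orr. Qed.

Lemma cut_ctx G A B : G |-- A -> CAnd G A |-- B -> G |-- B.
Proof. by move=> hA; apply: TP_cut; apply: TP_and => //; apply: TP_id. Qed.

Lemma or_elim G A B C :
  G |-- COr A B -> CAnd G A |-- C -> CAnd G B |-- C -> G |-- C.
Proof.
move=> hAB hA hB; apply: cut_ctx hAB _.
by apply: TP_cut (TP_distr _ _ _) _; apply: TP_or.
Qed.

Lemma or_mono A A' B B' : A |-- A' -> B |-- B' -> COr A B |-- COr A' B'.
Proof.
by move=> hA hB; apply: TP_or; [apply: or_intro_l|apply: or_intro_r].
Qed.

Lemma and_mono A A' B B' : A |-- A' -> B |-- B' -> CAnd A B |-- CAnd A' B'.
Proof.
move=> hA hB; apply: TP_and; first exact: weaken.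
exact: TP_cut (TP_andr _ _) hB.
Qed.

Lemma cshift_proves A B : A |-- B -> cshift A |-- cshift B.
Proof. exact: TP_subst. Qed.

Lemma ex_elim G (A : cform n.+1) C :
  G |-- CEx A -> CAnd (cshift G) A |-- cshift C -> G |-- C.
Proof.
move=> hEx hA; apply: cut_ctx hEx _; apply: TP_cut (TP_frobenius _ _) _.
exact: TP_ex_down.
Qed.

Lemma ex_intro_var (A : cform n.+1) : A |-- cshift (CEx A).
Proof. exact: TP_ex_up (TP_id _). Qed.

Lemma ex_intro G (A : cform n.+1) t : G |-- csubst (inst t) A -> G |-- CEx A.
Proof.
move/TP_cut; apply; have := TP_subst (inst t) (ex_intro_var A).
by simpl_subst.
Qed.

Lemma induction_on G (A : cform n.+1) t : G |-- csubst (inst Zero) A ->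
  CAnd (cshift G) A |-- csubst (@succ_inst n) A -> G |-- csubst (inst t) A.
Proof. by move=> h0 hS; have := TP_subst (inst t) (TP_indR h0 hS); simpl_subst. Qed.

Lemma CEq_refl G t : G |-- CEq t t.
Proof. exact: TP_cut (TP_top G) (TP_refl t). Qed.

Lemma CEq_rew G s t (A : cform n.+1) :
  G |-- CEq s t -> G |-- csubst (inst s) A -> G |-- csubst (inst t) A.
Proof. by move=> hst hA; apply: TP_cut (TP_leibniz s t A); apply: TP_and. Qed.

Lemma CEq_tsubst G s t (u : tm n.+1) :
  G |-- CEq s t -> G |-- CEq (tsubst (inst s) u) (tsubst (inst t) u).
Proof.
move=> hst.
have := CEq_rew (A := CEq (tsubst (@shift n) (tsubst (inst s) u)) u) hst.
by simpl_subst; apply; apply: CEq_refl.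
Qed.

Lemma CEq_sym G s t : G |-- CEq s t -> G |-- CEq t s.
Proof.
move=> hst; have := CEq_rew (A := CEq (Var ord0) (tsubst (@shift n) s)) hst.
by simpl_subst; apply; apply: CEq_refl.
Qed.

Lemma CEq_trans G s t u : G |-- CEq s t -> G |-- CEq t u -> G |-- CEq s u.
Proof.
move=> hst htu; have := CEq_rew (A := CEq (tsubst (@shift n) s) (Var ord0)) htu.
by simpl_subst; apply.
Qed.

Lemma CEq_Succ G s t : G |-- CEq s t -> G |-- CEq (Succ s) (Succ t).
Proof. by move/(CEq_tsubst (Succ (Var ord0))); simpl_subst. Qed.

Lemma CEq_Add G s s' t t' :
  G |-- CEq s s' -> G |-- CEq t t' -> G |-- CEq (Add s t) (Add s' t').
Proof.
move=> /(CEq_tsubst (Add (Var ord0) (tsubst (@shift n) t))) hs.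
move=> /(CEq_tsubst (Add (tsubst (@shift n) s') (Var ord0))) ht.
by move: hs ht; simpl_subst; apply: CEq_trans.
Qed.

Lemma CLt_CEq_trans G s t u : G |-- CLt s t -> G |-- CEq t u -> G |-- CLt s u.
Proof.
move=> hst htu; have := CEq_rew (A := CLt (tsubst (@shift n) s) (Var ord0)) htu.
by simpl_subst; apply.
Qed.

Lemma CEq_CLt_trans G s t u : G |-- CEq s t -> G |-- CLt t u -> G |-- CLt s u.
Proof.
move=> hst htu.
have := CEq_rew (A := CLt (Var ord0) (tsubst (@shift n) u)) (CEq_sym hst).
by simpl_subst; apply.
Qed.

End CoherentRules.

Ltac by_ctx := solve [do ?[exact: TP_id | exact: TP_andr | apply: weaken]].

(** * Arithmetic in T *)

Section DefiningEquations.
Variables (n : nat) (G : cform n).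

Lemma def_eqn_tsubst k (r : 'I_k -> tm n) s t :
  def_eqn s t -> G |-- CEq (tsubst r s) (tsubst r t).
Proof. move=> h; exact: TP_cut (TP_top G) (TP_subst r (TP_ax (T_def h))). Qed.

Lemma app_PrZ (r : 'I_1 -> tm n) : G |-- CEq (App PrZ r) Zero.
Proof. exact: (def_eqn_tsubst r DefZ). Qed.

Lemma app_PrProj k (i : 'I_k) (r : 'I_k -> tm n) :
  G |-- CEq (App (PrProj i) r) (r i).
Proof. exact: (def_eqn_tsubst r (DefProj i)). Qed.

Lemma app_PrCn k l (h : primrec k) (g : 'I_k -> primrec l) (r : 'I_l -> tm n) :
  G |-- CEq (App (PrCn h g) r) (App h (fun i => App (g i) r)).
Proof. exact: (def_eqn_tsubst r (DefCn h g)). Qed.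

Lemma app_PrPr_Zero k (g : primrec k) (h : primrec k.+2) (r : 'I_k -> tm n) :
  G |-- CEq (App (PrPr g h) (snoc r Zero)) (App g r).
Proof.
have := def_eqn_tsubst r (DefPr0 g h).
by rewrite /= -/(snoc _ _ >> r) tcomp_snoc tcomp_Var_l.
Qed.

Lemma app_PrPr_Succ k (g : primrec k) (h : primrec k.+2) (r : 'I_k -> tm n) b :
  G |-- CEq (App (PrPr g h) (snoc r (Succ b)))
            (App h (snoc (snoc r b) (App (PrPr g h) (snoc r b)))).
Proof.
have := def_eqn_tsubst (scons b r) (DefPrS g h).
rewrite /= -!/(snoc _ _ >> _) !tcomp_snoc tcomp_shift /= scons0.
by rewrite -/(snoc _ _ >> _) tcomp_snoc tcomp_shift /= scons0.
Qed.

Lemma Add_Zero a : G |-- CEq (Add a Zero) a.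
Proof.
rewrite /Add -(snoc_tuple2 (fun=> a)).
exact: CEq_trans (app_PrPr_Zero _ _ _) (app_PrProj _ _).
Qed.

Lemma Add_Succ a b : G |-- CEq (Add a (Succ b)) (Succ (Add a b)).
Proof.
rewrite /Add -!(snoc_tuple2 (fun=> a)).
apply: CEq_trans (app_PrPr_Succ _ _ _ _) _; apply: CEq_trans (app_PrCn _ _ _) _.
apply: CEq_Succ; apply: CEq_trans (app_PrProj _ _) _.
by rewrite snoc_max; apply: CEq_refl.
Qed.

Lemma Mul_Zero a : G |-- CEq (Mul a Zero) Zero.
Proof.
rewrite /Mul -(snoc_tuple2 (fun=> a)).
exact: CEq_trans (app_PrPr_Zero _ _ _) (app_PrZ _).
Qed.

Lemma Mul_Succ a b : G |-- CEq (Mul a (Succ b)) (Add (Mul a b) a).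
Proof.
rewrite /Mul -!(snoc_tuple2 (fun=> a)).
apply: CEq_trans (app_PrPr_Succ _ _ _ _) _; apply: CEq_trans (app_PrCn _ _ _) _.
set args := snoc _ _.
have -> : App PrAdd (fun i =>
      App (tnth [tuple PrProj (ord_max : 'I_3); PrProj (ord0 : 'I_3)] i) args) =
    Add (App (PrProj ord_max) args) (App (PrProj ord0) args).
  by congr App; apply: functional_extensionality => -[[|[|i]] //= ?].
apply: CEq_Add; apply: CEq_trans (app_PrProj _ _) _; rewrite /args.
  by rewrite snoc_max; apply: CEq_refl.
have -> : (ord0 : 'I_3) = lift ord_max (lift ord_max ord0) by apply: val_inj.
by rewrite !snoc_lift; apply: CEq_refl.
Qed.

End DefiningEquations.

Section Peano.
Variable n : nat.
Implicit Types (G C : cform n) (a b c : tm n).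

Lemma Succ_neq0 G a : G |-- CEq (Succ a) Zero -> G |-- CBot.
Proof. by move/TP_cut; apply; apply: (TP_subst (fun=> a) (TP_ax T_succ_neq0)). Qed.

Lemma Succ_inj G a b : G |-- CEq (Succ a) (Succ b) -> G |-- CEq a b.
Proof.
move/TP_cut; apply; have := TP_subst (tnth [tuple a; b]) (TP_ax T_succ_inj).
by simpl_subst.
Qed.

Lemma CLt_elim G a b C : G |-- CLt a b ->
  CAnd (cshift G) (CEq (Add (tsubst (@shift n) a) (Succ (Var ord0)))
                       (tsubst (@shift n) b)) |-- cshift C ->
  G |-- C.
Proof.
move=> hab; apply: ex_elim; apply: TP_cut hab _.
have := TP_subst (tnth [tuple a; b]) (TP_ax T_lt_ex).
by simpl_subst.
Qed.

Lemma CLt_intro G a b c : G |-- CEq (Add a (Succ c)) b -> G |-- CLt a b.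
Proof.
move=> hc; have := TP_subst (tnth [tuple a; b]) (TP_ax T_ex_lt).
simpl_subst; apply: TP_cut; apply: (ex_intro (t := c)).
by simpl_subst.
Qed.

Lemma zero_or_succ G a :
  G |-- COr (CEq a Zero) (CEx (CEq (tsubst (@shift n) a) (Succ (Var ord0)))).
Proof.
have := @induction_on _ G (COr (CEq (Var ord0) Zero)
  (CEx (CEq (Var (lift ord0 ord0)) (Succ (Var ord0))))) a.
simpl_subst; apply; first by apply: or_intro_l; apply: CEq_refl.
apply: or_intro_r; apply: (ex_intro (t := Var ord0)).
by simpl_subst; apply: CEq_refl.
Qed.

Lemma nat_case G a C : CAnd G (CEq a Zero) |-- C ->
  CAnd (cshift G) (CEq (tsubst (@shift n) a) (Succ (Var ord0))) |-- cshift C ->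
  G |-- C.
Proof.
move=> h0 hS; apply: or_elim (zero_or_succ G a) h0 _.
apply: ex_elim (TP_andr _ _) _; apply: TP_cut hS.
by apply: and_mono (TP_andl _ _) (TP_id _).
Qed.

Lemma Zero_Add G a : G |-- CEq (Add Zero a) a.
Proof.
have := @induction_on _ G (CEq (Add Zero (Var ord0)) (Var ord0)) a.
simpl_subst; apply; first exact: Add_Zero.
by apply: CEq_trans (Add_Succ _ _ _) _; apply: CEq_Succ; apply: TP_andr.
Qed.

Lemma Succ_Add G a b : G |-- CEq (Add (Succ a) b) (Succ (Add a b)).
Proof.
pose a' := tsubst (@shift n) a.
have := @induction_on _ G
  (CEq (Add (Succ a') (Var ord0)) (Succ (Add a' (Var ord0)))) b.
rewrite /a'; simpl_subst; apply.
  by apply: CEq_trans (Add_Zero _ _) _; apply: CEq_Succ (CEq_sym (Add_Zero _ _)).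
apply: CEq_trans (Add_Succ _ _ _) _; apply: CEq_Succ.
by apply: CEq_trans (TP_andr _ _) _; apply: CEq_sym; apply: Add_Succ.
Qed.

Lemma AddA G a b c : G |-- CEq (Add a (Add b c)) (Add (Add a b) c).
Proof.
pose a' := tsubst (@shift n) a; pose b' := tsubst (@shift n) b.
have := @induction_on _ G
  (CEq (Add a' (Add b' (Var ord0))) (Add (Add a' b') (Var ord0))) c.
rewrite /a' /b'; simpl_subst; apply.
  apply: CEq_trans (CEq_sym (Add_Zero _ _)).
  by apply: CEq_Add; [apply: CEq_refl|apply: Add_Zero].
apply: CEq_trans (CEq_sym (Add_Succ _ _ _)).
apply: CEq_trans (CEq_Add (CEq_refl _ _) (Add_Succ _ _ _)) _.
by apply: CEq_trans (Add_Succ _ _ _) _; apply: CEq_Succ; apply: TP_andr.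
Qed.

End Peano.

(* IndL refutes [y + s c = y] by descent on y. *)
Lemma Add_Succ_neq n (G : cform n) a c : G |-- CEq (Add a (Succ c)) a -> G |-- CBot.
Proof.
move=> h; apply: TP_cut h _.
pose fix_y := CEq (Add (Var ord0) (Succ (tsubst (@shift n) c))) (Var ord0).
have: fix_y |-- cshift CBot.
  apply: TP_indL; rewrite /fix_y; simpl_subst.
    by apply: Succ_neq0; apply: CEq_trans (CEq_sym (Add_Succ _ _ _)) (TP_id _).
  apply: or_intro_r; apply: Succ_inj; apply: CEq_trans (TP_id _).
  by apply: CEq_sym; apply: Succ_Add.
by move/(TP_subst (inst a)); rewrite /fix_y; simpl_subst.
Qed.

Lemma CLt_irrefl n (G : cform n) a : G |-- CLt a a -> G |-- CBot.
Proof. by move/CLt_elim; apply; apply: Add_Succ_neq (TP_andr _ _). Qed.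

Lemma CLt0_false n (G : cform n) a : G |-- CLt a Zero -> G |-- CBot.
Proof.
move/CLt_elim; apply.
by apply: Succ_neq0; apply: CEq_trans (CEq_sym (Add_Succ _ _ _)) (TP_andr _ _).
Qed.

Lemma Zero_CLt_Succ n (G : cform n) a : G |-- CLt Zero (Succ a).
Proof. exact: CLt_intro (Zero_Add G (Succ a)). Qed.

Lemma CLt_Succ n (G : cform n) a : G |-- CLt a (Succ a).
Proof.
apply: (CLt_intro (c := Zero)).
by apply: CEq_trans (Add_Succ _ _ _) _; apply: CEq_Succ; apply: Add_Zero.
Qed.

Lemma CLt_trans n (G : cform n) a b c :
  G |-- CLt a b -> G |-- CLt b c -> G |-- CLt a c.
Proof.
move=> hab hbc; apply: CLt_elim hab _.
apply: CLt_elim (weaken _ (cshift_proves hbc)) _.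
apply: (CLt_intro (c := Add (Succ (Var (lift ord0 ord0))) (Var ord0))); simpl_subst.
apply: CEq_trans (TP_andr _ _).
apply: (CEq_trans (CEq_Add (CEq_refl _ _) (CEq_sym (Add_Succ _ _ _)))).
apply: (CEq_trans (AddA _ _ _ _)).
by apply: CEq_Add (CEq_refl _ _); by_ctx.
Qed.

Lemma CLt_asym n (G : cform n) a b : G |-- CLt a b -> G |-- CLt b a -> G |-- CBot.
Proof. by move=> hab hba; apply: CLt_irrefl (CLt_trans hab hba). Qed.

Lemma CLe_intro n (G : cform n) a b c : G |-- CEq (Add a c) b -> G |-- CLe a b.
Proof.
move=> hc; apply: (nat_case (a := c)).
  apply: or_intro_r; apply: CEq_trans (weaken _ hc).
  apply: CEq_trans (CEq_sym (Add_Zero _ _)) _; apply: CEq_Add (CEq_refl _ _) _.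
  by apply: CEq_sym; apply: TP_andr.
apply: or_intro_l; apply: (CLt_intro (c := Var ord0)).
apply: CEq_trans (weaken _ (cshift_proves hc)); simpl_subst.
by apply: CEq_Add (CEq_refl _ _) _; apply: CEq_sym; apply: TP_andr.
Qed.

Lemma CLtS_CLe n (G : cform n) a b : G |-- CLt a (Succ b) -> G |-- CLe a b.
Proof.
move/CLt_elim; apply; simpl_subst; apply: (CLe_intro (c := Var ord0)).
apply: Succ_inj; apply: CEq_trans (TP_andr _ _).
by apply: CEq_sym; apply: Add_Succ.
Qed.

Lemma CLt_CLeS n (G : cform n) a b : G |-- CLt a b -> G |-- CLe (Succ a) b.
Proof.
move/CLt_elim; apply; simpl_subst; apply: (CLe_intro (c := Var ord0)).
apply: CEq_trans (TP_andr _ _).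
by apply: CEq_trans (Succ_Add _ _ _) _; apply: CEq_sym; apply: Add_Succ.
Qed.

Lemma CLt_or_CLe n (G : cform n) a b : G |-- COr (CLt a b) (CLe b a).
Proof.
pose a' := tsubst (@shift n) a.
have := @induction_on _ G (COr (CLt a' (Var ord0)) (CLe (Var ord0) a')) b.
rewrite /a'; simpl_subst; apply.
  apply: (nat_case (a := a)).
    by do 2!apply: or_intro_r; apply: CEq_sym; apply: TP_andr.
  simpl_subst; apply: or_intro_r; apply: or_intro_l.
  by apply: CLt_CEq_trans (Zero_CLt_Succ _ _) (CEq_sym (TP_andr _ _)).
apply: or_elim (TP_andr _ _) _ _.
  by apply: or_intro_l; apply: CLt_trans (TP_andr _ _) (CLt_Succ _ _).
apply: or_elim (TP_andr _ _) _ _.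
  by apply: or_intro_r; apply: CLt_CLeS; apply: TP_andr.
by apply: or_intro_l; apply: CEq_CLt_trans (CEq_sym (TP_andr _ _)) (CLt_Succ _ _).
Qed.

Lemma CLt_CLe_false n (G : cform n) a b :
  G |-- CLt a b -> G |-- CLe b a -> G |-- CBot.
Proof.
move=> hab hba; apply: or_elim hba _ _.
  by apply: CLt_asym (weaken _ hab) (TP_andr _ _).
by apply: CLt_irrefl; apply: CLt_CEq_trans (weaken _ hab) (TP_andr _ _).
Qed.

Lemma ball_Succ n (G : cform n) t (A : cform n.+1) :
  G |-- CBAll t A -> G |-- csubst (inst t) A -> G |-- CBAll (Succ t) A.
Proof.
move=> hlt heq; apply: TP_ball_down.
apply: or_elim (CLtS_CLe (TP_andr _ _)) _ _.
  apply: TP_cut (TP_ball_up hlt); apply: and_mono (TP_id _).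
  exact: TP_andl.
set H := CAnd _ _.
have := CEq_rew (A := csubst (up (@shift n)) A) (CEq_sym (TP_andr _ _ : H |-- _)).
simpl_subst; apply.
by do 2!apply: weaken; have := cshift_proves heq; simpl_subst.
Qed.

Lemma ball_or_of_all n (G D : cform n) t (A : cform n.+1) :
  cshift G |-- COr A (cshift D) -> G |-- COr (CBAll t A) D.
Proof.
move=> hA.
have := @induction_on _ G
  (COr (CBAll (Var ord0) (csubst (up (@shift n)) A)) (cshift D)) t.
simpl_subst; apply.
  apply: or_intro_l; apply: TP_ball_down.
  exact: bot_elim (CLt0_false (TP_andr _ _)).
apply: or_elim (TP_andr _ _) _ _; last by apply: or_intro_r; apply: TP_andr.
apply: (@or_elim _ _ A (cshift D)); first by do 2!apply: weaken.
  apply: or_intro_l; apply: ball_Succ; first by_ctx.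
  by simpl_subst; by_ctx.
by apply: or_intro_r; apply: TP_andr.
Qed.

(* The dual Frobenius law is not a rule of T.  It follows from the previous
   lemma for the matrix [A \/ t <= z], where z need not be bounded. *)
Lemma ball_or n t (A : cform n.+1) (D : cform n) :
  CBAll t (COr A (cshift D)) |-- COr (CBAll t A) D.
Proof.
pose t' := tsubst (@shift n) t.
have strip_bound : CBAll t (COr A (CLe t' (Var ord0))) |-- CBAll t A.
  apply: TP_ball_down; apply: or_elim (TP_ball_up (TP_id _)) _ _; first exact: TP_andr.
  apply: bot_elim; apply: CLt_CLe_false (TP_andr _ _).
  by apply: weaken; apply: TP_andr.
apply: TP_cut (or_mono strip_bound (TP_id _)); apply: ball_or_of_all.
apply: or_elim (CLt_or_CLe _ (Var ord0) t') _ _.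
  by apply: TP_cut (TP_ball_up (TP_id _)) (or_mono (TP_orl _ _) (TP_id _)).
by apply: or_intro_l; apply: or_intro_r; apply: TP_andr.
Qed.

(** * Complements *)

Definition complement n (A B : cform n) : Prop :=
  CTop |-- COr A B /\ CAnd A B |-- CBot.

Section Complements.
Variable n : nat.
Implicit Types (A B C : cform n) (s t : tm n).

Lemma complement_sym A B : complement A B -> complement B A.
Proof.
case=> cover disj; split.
  by apply: TP_cut cover (TP_or (TP_orr _ _) (TP_orl _ _)).
by apply: TP_cut (TP_and (TP_andr _ _) (TP_andl _ _)) disj.
Qed.

Lemma complement_csubst m (r : 'I_n -> tm m) A B :
  complement A B -> complement (csubst r A) (csubst r B).
Proof. by case=> /(TP_subst r) cover /(TP_subst r) disj. Qed.

Lemma complement_lt s t : complement (CLt s t) (CLe t s).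
Proof.
split; first exact: CLt_or_CLe.
by apply: CLt_CLe_false (TP_andl _ _) (TP_andr _ _).
Qed.

Lemma complement_eq s t : complement (CEq s t) (COr (CLt s t) (CLt t s)).
Proof.
split.
  apply: or_elim (CLt_or_CLe _ s t) _ _.
    by apply: or_intro_r; apply: or_intro_l; apply: TP_andr.
  apply: or_elim (TP_andr _ _) _ _.
    by do 2!apply: or_intro_r; apply: TP_andr.
  by apply: or_intro_l; apply: CEq_sym; apply: TP_andr.
apply: or_elim (TP_andr _ _) _ _; apply: CLt_irrefl.
  by apply: CLt_CEq_trans (TP_andr _ _) (CEq_sym _); by_ctx.
by apply: CLt_CEq_trans (TP_andr _ _) _; by_ctx.
Qed.

Lemma complement_top : complement (@CTop n) CBot.
Proof. by split; [apply: TP_orl|apply: TP_andr]. Qed.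

Lemma complement_and A A' B B' :
  complement A B -> complement A' B' -> complement (CAnd A A') (COr B B').
Proof.
move=> [cover disj] [cover' disj']; split.
  apply: or_elim cover _ _; last first.
    by apply: or_intro_r; apply: or_intro_l; apply: TP_andr.
  apply: or_elim (TP_cut (TP_top _) cover') _ _.
    by apply: or_intro_l; apply: and_mono (TP_andr _ _) (TP_id _).
  by do 2!apply: or_intro_r; apply: TP_andr.
apply: or_elim (TP_andr _ _) _ _.
  by apply: TP_cut disj; apply: and_mono (TP_id _); apply: weaken; apply: TP_andl.
by apply: TP_cut disj'; apply: and_mono (TP_id _); apply: weaken; apply: TP_andr.
Qed.

Lemma complement_or A A' B B' :
  complement A B -> complement A' B' -> complement (COr A A') (CAnd B B').
Proof.
by move=> hA hA'; apply/complement_sym/complement_and; apply: complement_sym.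
Qed.

Lemma complement_ball t (A B : cform n.+1) : complement A B ->
  complement (CBAll t A) (CEx (CAnd (CLt (Var ord0) (tsubst (@shift n) t)) B)).
Proof.
move=> [cover disj]; split.
  apply: TP_cut (ball_or _ _ _); apply: TP_ball_down.
  apply: or_elim (TP_cut (TP_top _) cover) _ _.
    by apply: or_intro_l; apply: TP_andr.
  apply: or_intro_r; apply: TP_cut (ex_intro_var _).
  by apply: and_mono (TP_andr _ _) (TP_id _).
apply: ex_elim (TP_andr _ _) _; apply: TP_cut disj; apply: TP_and.
  apply: TP_cut (TP_ball_up (TP_id (CBAll t A))).
  by apply: and_mono (TP_andl _ _) (TP_andl _ _).
by apply: TP_cut (TP_andr _ _) (TP_andr _ _).
Qed.

End Complements.

(** * Conditions *)

(* A condition is read "asserted holds and denied fails". *)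
Record condition m := Condition { asserted : cform m; denied : cform m }.

Definition cond_subst n m (s : 'I_n -> tm m) (p : condition n) : condition m :=
  Condition (csubst s (asserted p)) (csubst s (denied p)).

Definition cond_shift m (p : condition m) : condition m.+1 :=
  cond_subst (@shift m) p.

Definition extends n m (s : 'I_n -> tm m) (p : condition n) (q : condition m) : Prop :=
  asserted q |-- asserted (cond_subst s p) /\ denied (cond_subst s p) |-- denied q.

Definition assume m (p : condition m) (A : cform m) : condition m :=
  Condition (CAnd (asserted p) A) (denied p).

Definition deny m (p : condition m) (A : cform m) : condition m :=
  Condition (asserted p) (COr A (denied p)).

Definition inconsistent m (p : condition m) : Prop := asserted p |-- denied p.

Definition entails m (p : condition m) (A : cform m) : Prop := inconsistent (deny p A).

Section Conditions.
Variable m : nat.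
Implicit Types (p : condition m) (A B C : cform m).

Lemma extends_refl p : extends (@Var m) p p.
Proof. by split; rewrite /= csubst_Var; apply: TP_id. Qed.

Lemma extends_trans l j (s : 'I_m -> tm l) (r : 'I_l -> tm j) p q o :
  extends s p q -> extends r q o -> extends (s >> r) p o.
Proof.
move=> [hq1 hq2] [ho1 ho2]; split; rewrite /= -csubst_tcomp.
  by apply: TP_cut ho1 _; apply: TP_subst.
by apply: TP_cut ho2; apply: TP_subst.
Qed.

Lemma extends_cond_subst l (s : 'I_m -> tm l) p : extends s p (cond_subst s p).
Proof. by split; apply: TP_id. Qed.

Lemma extends_assume p A : extends (@Var m) p (assume p A).
Proof. by split; rewrite /= csubst_Var; [apply: TP_andl|apply: TP_id]. Qed.

Lemma extends_deny p A : extends (@Var m) p (deny p A).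
Proof. by split; rewrite /= csubst_Var; [apply: TP_id|apply: TP_orr]. Qed.

Lemma assume_extends l (s : 'I_m -> tm l) p q A :
  extends s p q -> extends s (assume p A) (assume q (csubst s A)).
Proof. by case=> hG hD; split=> //=; apply: and_mono hG (TP_id _). Qed.

Lemma deny_extends l (s : 'I_m -> tm l) p q A :
  extends s p q -> extends s (deny p A) (deny q (csubst s A)).
Proof. by case=> hG hD; split=> //=; apply: or_mono (TP_id _) hD. Qed.

Lemma inconsistent_extends l (s : 'I_m -> tm l) p q :
  extends s p q -> inconsistent p -> inconsistent q.
Proof. by case=> hG hD /(TP_subst s) hp; apply: TP_cut hG (TP_cut hp hD). Qed.

Lemma entails_extends l (s : 'I_m -> tm l) p q A :
  extends s p q -> entails p A -> entails q (csubst s A).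
Proof. by move/(deny_extends A); apply: inconsistent_extends. Qed.

Lemma entails_intro p A : asserted p |-- A -> entails p A.
Proof. exact: or_intro_l. Qed.

Lemma entails_assume p A : entails (assume p A) A.
Proof. by apply: entails_intro; apply: TP_andr. Qed.

Lemma entails_weaken p A B : entails p B -> entails (assume p A) B.
Proof. exact: weaken. Qed.

Lemma entails_mono p A B : A |-- B -> entails p A -> entails p B.
Proof. by move=> hAB hA; apply: TP_cut hA (or_mono hAB (TP_id _)). Qed.

Lemma inconsistent_cut p A : entails p A -> inconsistent (assume p A) -> inconsistent p.
Proof. by move=> hA hp; apply: or_elim hA hp (TP_andr _ _). Qed.

Lemma entails_cut p A B : entails p A -> entails (assume p A) B -> entails p B.
Proof.
move=> hA; apply: (@inconsistent_cut (deny p B) A).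
by have := entails_extends (extends_deny p B) hA; rewrite csubst_Var.
Qed.

Lemma entails_and p A B : entails p (CAnd A B) <-> entails p A /\ entails p B.
Proof.
split=> [hAB|[hA hB]].
  by split; apply: entails_mono hAB; [apply: TP_andl|apply: TP_andr].
apply: entails_cut hA _; apply: (entails_cut (B := CAnd A B)).
  exact: entails_weaken hB.
by apply: entails_intro; apply: and_mono (TP_andr _ _) (TP_id _).
Qed.

Lemma entails_bot p : entails p CBot <-> inconsistent p.
Proof.
split=> h; last exact: or_intro_r.
by apply: inconsistent_cut h _; apply: bot_elim (TP_andr _ _).
Qed.

Lemma inconsistent_assume_or p A B :
  inconsistent (assume p (COr A B)) <->
  inconsistent (assume p A) /\ inconsistent (assume p B).
Proof.
split=> [h|[hA hB]].
  split; apply: TP_cut h; apply: and_mono (TP_id _) _;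
    [exact: TP_orl|exact: TP_orr].
exact: TP_cut (TP_distr _ _ _) (TP_or hA hB).
Qed.

Lemma inconsistent_assume_ex p (A : cform m.+1) :
  inconsistent (assume p (CEx A)) <-> inconsistent (assume (cond_shift p) A).
Proof.
split=> h; last exact: TP_cut (TP_frobenius _ _) (TP_ex_down h).
apply: TP_cut (cshift_proves h); apply: and_mono (TP_id _) _.
exact: ex_intro_var.
Qed.

Lemma entails_or_elim p A B C : entails p (COr A B) ->
  entails (assume p A) C -> entails (assume p B) C -> entails p C.
Proof.
move=> hAB hA hB; apply: entails_cut hAB _.
by apply/(@inconsistent_assume_or (deny p C)); split.
Qed.

Lemma entails_assume_complement p A B C :
  complement A C -> entails (assume p A) B <-> entails p (COr C B).
Proof.
case=> cover disj; split=> h.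
  apply: entails_or_elim (entails_intro (TP_cut (TP_top _) cover)) _ _.
    exact: entails_mono (TP_orr _ _) h.
  by apply: entails_intro; apply: or_intro_l; apply: TP_andr.
apply: entails_or_elim (entails_weaken A h) _ (entails_assume _ _).
apply: entails_intro; apply: bot_elim; apply: TP_cut disj.
exact: and_mono (TP_andr _ _) (TP_id _).
Qed.

End Conditions.

Lemma entails_ball m (p : condition m) t (A : cform m.+1) :
  entails p (CBAll t A) <->
  entails (assume (cond_shift p) (CLt (Var ord0) (tsubst (@shift m) t))) A.
Proof.
split=> h; last by apply: TP_cut (ball_or _ _ _); apply: TP_ball_down.
apply: (entails_cut (A := cshift (CBAll t A))).
  exact: entails_weaken (entails_extends (extends_cond_subst (@shift m) p) h).
apply: entails_intro; apply: TP_cut (TP_ball_up (TP_id (CBAll t A))).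
by apply: TP_and; [apply: TP_andr|by_ctx].
Qed.

(* IndR with the induction formula [A \/ denied p]. *)
Lemma entails_induction m (p : condition m) (A : cform m.+1) :
  entails p (csubst (inst Zero) A) ->
  entails (assume (cond_shift p) A) (csubst (@succ_inst m) A) ->
  entails (cond_shift p) A.
Proof.
rewrite /entails /inconsistent /= => h0 hS.
apply: (TP_indR (phi := COr A (cshift (denied p)))).
  by move: h0; simpl_subst.
apply: or_elim (TP_andr _ _) _ _; simpl_subst.
  by apply: TP_cut hS; apply: and_mono (TP_andl _ _) (TP_id _).
by apply: or_intro_r; apply: TP_andr.
Qed.

(** * Forcing *)

(* The terms assigned to the k variables live in the context of the condition. *)
Definition sem k := forall m, condition m -> ('I_k -> tm m) -> Prop.

Definition semBot k : sem k := fun m p _ => inconsistent p.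
Definition semAtom k (A : cform k) : sem k := fun m p r => entails p (csubst r A).
Definition semAnd k (S S' : sem k) : sem k := fun m p r => S m p r /\ S' m p r.
Definition semImp k (S S' : sem k) : sem k := fun m p r =>
  forall l (s : 'I_m -> tm l) q, extends s p q -> S l q (r >> s) -> S' l q (r >> s).
Definition semAll k (S : sem k.+1) : sem k := fun m p r =>
  forall l (s : 'I_m -> tm l) q, extends s p q -> forall t, S l q (scons t (r >> s)).
Definition semNot k (S : sem k) : sem k := semImp S (@semBot k).
Definition semOr k (S S' : sem k) : sem k := semNot (semAnd (semNot S) (semNot S')).
Definition semEx k (S : sem k.+1) : sem k := semNot (semAll (semNot S)).

Fixpoint forces k (A : fform k) : sem k :=
  match A with
  | FEq s t => semAtom (CEq s t)
  | FLt s t => semAtom (CLt s t)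
  | FTop => semAtom CTop
  | FBot => @semBot k
  | FAnd A B => semAnd (forces A) (forces B)
  | FOr A B => semOr (forces A) (forces B)
  | FImp A B => semImp (forces A) (forces B)
  | FEx A => semEx (forces A)
  | FAll A => semAll (forces A)
  end.

Definition valid k (A : fform k) : Prop := forall m (p : condition m) r, forces A p r.

Lemma sem_eq k (S S' : sem k) : (forall m p r, S m p r <-> S' m p r) -> S = S'.
Proof.
move=> eqS; do 3!apply: functional_extensionality_dep => ?.
exact: propositional_extensionality.
Qed.

Lemma semBot_atom k : @semBot k = semAtom CBot.
Proof. by apply: sem_eq => m p r; rewrite /semAtom entails_bot. Qed.

Lemma forces_ind (P : forall k, sem k -> Prop) :
  (forall k (A : cform k), P k (semAtom A)) ->
  (forall k (S S' : sem k), P k S -> P k S' -> P k (semAnd S S')) ->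
  (forall k (S S' : sem k), P k S -> P k S' -> P k (semImp S S')) ->
  (forall k (S : sem k.+1), P k.+1 S -> P k (semAll S)) ->
  forall k (A : fform k), P k (forces A).
Proof.
move=> Patom Pand Pimp Pall.
have Pbot k : P k (@semBot k) by rewrite semBot_atom.
have Pnot k (S : sem k) : P k S -> P k (semNot S) by move=> PS; apply: Pimp.
move=> k A; elim: A => {k} /= k; try by auto.
- by move=> A IA B IB; apply/Pnot/Pand; apply: Pnot.
- by move=> A IA; apply/Pnot/Pall/Pnot.
Qed.

Definition persistent k (S : sem k) : Prop := forall m l (s : 'I_m -> tm l) p q r,
  extends s p q -> S m p r -> S l q (r >> s).

Definition stable k (S : sem k) : Prop :=
  forall m p r, semNot (semNot S) p r -> S m p r.

Record regular k (S : sem k) : Prop :=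
  Regular { regular_persistent : persistent S; regular_stable : stable S }.

Lemma semImp_apply k (S S' : sem k) m (p : condition m) r :
  semImp S S' p r -> S m p r -> S' m p r.
Proof. by move/(_ m (@Var m) p (extends_refl p)); rewrite tcomp_Var_r. Qed.

Lemma semAll_apply k (S : sem k.+1) m (p : condition m) r t :
  semAll S p r -> S m p (scons t r).
Proof. by move/(_ m (@Var m) p (extends_refl p) t); rewrite tcomp_Var_r. Qed.

Lemma persistent_atom k (A : cform k) : persistent (semAtom A).
Proof.
move=> m l s p q r pq; rewrite /semAtom -csubst_tcomp.
exact: entails_extends.
Qed.

Lemma persistent_imp k (S S' : sem k) : persistent (semImp S S').
Proof.
move=> m l s p q r pq h l' s' q' qq'; rewrite tcompA.
exact: h (extends_trans pq qq').
Qed.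

Lemma persistent_all k (S : sem k.+1) : persistent (semAll S).
Proof.
move=> m l s p q r pq h l' s' q' qq'; rewrite tcompA.
exact: h (extends_trans pq qq').
Qed.

(* Denying A refutes A, and is consistent unless A is entailed. *)
Lemma regular_atom k (A : cform k) : regular (semAtom A).
Proof.
split=> [|m p r nnA]; first exact: persistent_atom.
apply: (nnA _ _ _ (extends_deny p (csubst r A))) => l s q [_ hD] hA.
rewrite tcomp_Var_r in hA; apply: TP_cut hA (TP_or _ (TP_id _)).
by apply: TP_cut hD; rewrite -csubst_tcomp; apply: TP_orl.
Qed.

Lemma regular_and k (S S' : sem k) :
  regular S -> regular S' -> regular (semAnd S S').
Proof.
move=> [pS sS] [pS' sS']; split=> [m l s p q r pq [hS hS']|m p r nn].
  by split; [apply: pS hS|apply: pS' hS'].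
split; [apply: sS|apply: sS'] => l s q pq nS;
  by apply: (nn _ _ _ pq) => l' s' q' qq' [hS hS']; apply: nS qq' _.
Qed.

Lemma regular_imp k (S S' : sem k) :
  regular S -> regular S' -> regular (semImp S S').
Proof.
move=> [pS _] [_ sS']; split=> [|m p r nn l s q pq hS]; first exact: persistent_imp.
apply: sS' => l1 s1 q1 qq1 nS'.
apply: (nn _ _ _ (extends_trans pq qq1)) => l2 s2 q2 q12 hSS'.
rewrite -!tcompA in hSS' *; apply: (nS' _ _ _ q12); apply: (semImp_apply hSS').
by apply: (pS _ _ _ _ _ _ q12); apply: pS qq1 hS.
Qed.

Lemma regular_all k (S : sem k.+1) : regular S -> regular (semAll S).
Proof.
move=> [_ sS]; split=> [|m p r nn l s q pq t]; first exact: persistent_all.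
apply: sS => l1 s1 q1 qq1; rewrite tcomp_scons tcompA => nS.
apply: (nn _ _ _ (extends_trans pq qq1)) => l2 s2 q2 q12 hS.
apply: (nS _ _ _ q12); rewrite tcomp_scons.
exact: semAll_apply hS.
Qed.

Lemma regular_forces k (A : fform k) : regular (forces A).
Proof.
apply: (@forces_ind (@regular)) => {k A} *.
- exact: regular_atom.
- exact: regular_and.
- exact: regular_imp.
- exact: regular_all.
Qed.

Lemma persistent_forces k (A : fform k) : persistent (forces A).
Proof. exact: regular_persistent (regular_forces A). Qed.

Lemma stable_forces k (A : fform k) : stable (forces A).
Proof. exact: regular_stable (regular_forces A). Qed.

Lemma semNot_semNot k (S : sem k) : regular S -> semNot (semNot S) = S.
Proof.
move=> [pS sS]; apply: sem_eq => m p r; split; first exact: sS.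
by move=> hS l s q pq /semImp_apply; apply; apply: pS pq hS.
Qed.

(* The generic extension of p by A is [assume p A], and the generic choice of
   a term is a fresh variable. *)
Lemma semImp_atomP k (A : cform k) (S : sem k) m (p : condition m) r :
  regular S -> semImp (semAtom A) S p r <-> S m (assume p (csubst r A)) r.
Proof.
move=> [pS sS]; split=> [h|hS l s q pq hA].
  have := h _ _ _ (extends_assume p (csubst r A)).
  by rewrite tcomp_Var_r; apply; apply: entails_assume.
apply: sS => l' s' q' qq' nS.
apply: inconsistent_cut (entails_extends qq' hA) _.
have := nS _ _ _ (extends_assume _ _).
rewrite tcomp_Var_r; apply; rewrite csubst_tcomp tcompA -csubst_tcomp.
exact: pS (assume_extends _ (extends_trans pq qq')) hS.
Qed.

Lemma semNot_atomP k (A : cform k) m (p : condition m) r :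
  semNot (semAtom A) p r <-> inconsistent (assume p (csubst r A)).
Proof. by rewrite /semNot semImp_atomP // semBot_atom; apply: regular_atom. Qed.

Lemma semAllP k (S : sem k.+1) m (p : condition m) r :
  persistent S -> semAll S p r <-> S m.+1 (cond_shift p) (up r).
Proof.
move=> pS; split=> [h|hS l s q pq t].
  exact: h (extends_cond_subst _ p) (Var ord0).
have := pS _ _ (scons t s) _ q _ _ hS.
rewrite up_tcomp_scons; apply.
by case: pq => hG hD; split; rewrite /= csubst_tcomp tcomp_shift.
Qed.

(** * Soundness of classical logic *)

Definition reindex k l (s : 'I_k -> tm l) (S : sem k) : sem l :=
  fun m p r => S m p (s >> r).

Lemma reindex_atom k l (s : 'I_k -> tm l) A :
  reindex s (semAtom A) = semAtom (csubst s A).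
Proof. by apply: sem_eq => m p r; rewrite /reindex /semAtom csubst_tcomp. Qed.

Lemma reindex_and k l (s : 'I_k -> tm l) S S' :
  reindex s (semAnd S S') = semAnd (reindex s S) (reindex s S').
Proof. by []. Qed.

Lemma reindex_imp k l (s : 'I_k -> tm l) S S' :
  reindex s (semImp S S') = semImp (reindex s S) (reindex s S').
Proof.
apply: sem_eq => m p r; rewrite /reindex /semImp.
by split=> h l' s' q pq; move: (h _ _ _ pq); rewrite tcompA.
Qed.

Lemma reindex_not k l (s : 'I_k -> tm l) S :
  reindex s (semNot S) = semNot (reindex s S).
Proof. exact: reindex_imp. Qed.

Lemma reindex_all k l (s : 'I_k -> tm l) S :
  reindex s (semAll S) = semAll (reindex (up s) S).
Proof.
apply: sem_eq => m p r; rewrite /reindex /semAll.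
by split=> h l' s' q pq t; move: (h _ _ _ pq t); rewrite up_tcomp_scons tcompA.
Qed.

Lemma forces_fsubst k l (s : 'I_k -> tm l) A :
  forces (fsubst s A) = reindex s (forces A).
Proof.
elim: A l s => {k} /=; try by move=> *; rewrite reindex_atom.
- by [].
- by move=> k A IA B IB l s; rewrite IA IB.
- by move=> k A IA B IB l s; rewrite reindex_not reindex_and !reindex_not IA IB.
- by move=> k A IA B IB l s; rewrite reindex_imp IA IB.
- by move=> k A IA l s; rewrite reindex_not reindex_all reindex_not IA.
- by move=> k A IA l s; rewrite reindex_all IA.
Qed.

Definition eq_invariant k (S : sem k) : Prop :=
  forall m (p : condition m) u v (r : 'I_k -> tm m.+1),
  entails p (CEq u v) -> S _ p (r >> inst u) -> S _ p (r >> inst v).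

Lemma entails_eq_sym m (p : condition m) u v :
  entails p (CEq u v) -> entails p (CEq v u).
Proof. exact: entails_mono (CEq_sym (TP_id _)). Qed.

Lemma eq_invariant_atom k (A : cform k) : eq_invariant (semAtom A).
Proof.
move=> m p u v r huv; rewrite /semAtom -!csubst_tcomp => hA.
apply: entails_mono (TP_leibniz u v _) _.
exact/entails_and.
Qed.

Lemma eq_invariant_and k (S S' : sem k) :
  eq_invariant S -> eq_invariant S' -> eq_invariant (semAnd S S').
Proof.
move=> iS iS' m p u v r huv [hS hS'].
by split; [apply: iS hS|apply: iS' hS'].
Qed.

Lemma eq_invariant_imp k (S S' : sem k) :
  eq_invariant S -> eq_invariant S' -> eq_invariant (semImp S S').
Proof.
move=> iS iS' m p u v r huv h l s q pq; have quv := entails_extends pq huv.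
rewrite tcompA inst_tcomp -tcompA => hS; apply: (iS' _ _ _ _ _ quv).
have := h _ _ _ pq; rewrite tcompA inst_tcomp -tcompA; apply.
exact: iS (entails_eq_sym quv) hS.
Qed.

Lemma eq_invariant_all k (S : sem k.+1) : eq_invariant S -> eq_invariant (semAll S).
Proof.
move=> iS m p u v r huv h l s q pq t.
have under_inst a : scons t (r >> inst a >> s) =
    scons (tsubst (@shift l) t) (r >> up s) >> inst (tsubst s a).
  by rewrite tcompA inst_tcomp -tcompA tcomp_scons tsubst_tcomp tcomp_shift tsubst_Var.
rewrite under_inst; apply: iS (entails_extends pq huv) _.
by rewrite -under_inst; apply: h.
Qed.

Lemma eq_invariant_forces k (A : fform k) : eq_invariant (forces A).
Proof.
apply: (@forces_ind (@eq_invariant)) => {k A} *.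
- exact: eq_invariant_atom.
- exact: eq_invariant_and.
- exact: eq_invariant_imp.
- exact: eq_invariant_all.
Qed.

Lemma semOr_intro_l k (S S' : sem k) m (p : condition m) r :
  persistent S -> S m p r -> semOr S S' p r.
Proof. by move=> pS hS l s q pq [/semImp_apply + _]; apply; apply: pS pq hS. Qed.

Lemma semOr_intro_r k (S S' : sem k) m (p : condition m) r :
  persistent S' -> S' m p r -> semOr S S' p r.
Proof. by move=> pS' hS' l s q pq [_ /semImp_apply]; apply; apply: pS' pq hS'. Qed.

Lemma semNot_contrapose k (S U : sem k) m l (s : 'I_m -> tm l) p q r :
  extends s p q -> semImp S U p r -> semNot U q (r >> s) -> semNot S q (r >> s).
Proof.
move=> pq hSU nU l' s' q' qq' hS; apply: (nU _ _ _ qq').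
rewrite tcompA; apply: (hSU _ _ _ (extends_trans pq qq')).
by rewrite -tcompA.
Qed.

Lemma semOr_elim k (S S' U : sem k) m (p : condition m) r : stable U ->
  semOr S S' p r -> semImp S U p r -> semImp S' U p r -> U m p r.
Proof.
move=> sU hor hSU hS'U; apply: sU => l s q pq nU; apply: (hor _ _ _ pq).
by split; [apply: semNot_contrapose hSU nU|apply: semNot_contrapose hS'U nU].
Qed.

Lemma semEx_intro k (S : sem k.+1) m (p : condition m) t r :
  persistent S -> S m p (scons t r) -> semEx S p r.
Proof.
move=> pS hS l s q pq nS; apply: semImp_apply (semAll_apply (tsubst s t) nS) _.
by rewrite -tcomp_scons; apply: pS pq hS.
Qed.

Lemma semEx_elim k (S : sem k.+1) (U : sem k) m (p : condition m) r : stable U ->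
  semEx S p r -> semAll (semImp S (reindex (@shift k) U)) p r -> U m p r.
Proof.
move=> sU hex hSU; apply: sU => l s q pq nU; apply: (hex _ _ _ pq).
move=> l1 s1 q1 qq1 t l2 s2 q2 q12 hS; apply: (nU _ _ _ (extends_trans qq1 q12)).
have := hSU _ _ _ (extends_trans pq qq1) t _ _ _ q12.
rewrite /reindex tcomp_scons tcomp_shift !tcompA; apply.
by move: hS; rewrite tcomp_scons !tcompA.
Qed.

Definition forces_all k (Gamma : seq (fform k)) : sem k :=
  fun m p r => List.Forall (fun B => forces B p r) Gamma.

Definition forced_by k (Gamma : seq (fform k)) (A : fform k) : Prop :=
  forall m (p : condition m) r, forces_all Gamma p r -> forces A p r.

Lemma persistent_forces_all k (Gamma : seq (fform k)) : persistent (forces_all Gamma).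
Proof.
move=> m l s p q r pq; apply: List.Forall_impl => B.
exact: persistent_forces.
Qed.

Lemma forced_by_impI k (Gamma : seq (fform k)) A B :
  forced_by (A :: Gamma) B -> forced_by Gamma (FImp A B).
Proof.
move=> hB m p r hGamma l s q pq hA; apply: hB; apply: List.Forall_cons => //.
exact: persistent_forces_all pq hGamma.
Qed.

Lemma forced_by_allI k (Gamma : seq (fform k)) (A : fform k.+1) :
  forced_by (map (@fshift k) Gamma) A -> forced_by Gamma (FAll A).
Proof.
move=> hA m p r hGamma l s q pq t; apply: hA; apply/List.Forall_map.
apply: List.Forall_impl (persistent_forces_all pq hGamma) => B.
by rewrite /fshift forces_fsubst /reindex tcomp_shift.
Qed.

Lemma forces_inst k (A : fform k.+1) t m (p : condition m) r :
  forces (fsubst (inst t) A) p r <-> forces A p (scons (tsubst r t) r).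
Proof. by rewrite forces_fsubst /reindex tcomp_scons tcomp_Var_l. Qed.

Lemma forces_eq k (A : fform k.+1) s t m (p : condition m) r :
  forces (FEq s t) p r ->
  forces (fsubst (inst s) A) p r -> forces (fsubst (inst t) A) p r.
Proof.
rewrite !forces_fsubst /reindex !inst_tcomp.
exact: eq_invariant_forces.
Qed.

Lemma soundness (Ax : fform 0 -> Prop) k (Gamma : seq (fform k)) A :
  (forall B, Ax B -> valid B) -> fol_proves Ax Gamma A -> forced_by Gamma A.
Proof.
move=> valid_Ax; elim=> {k Gamma A}.
- by move=> k Gamma A /valid_Ax vA m p r _; rewrite forces_fsubst; apply: vA.
- by move=> k Gamma1 Gamma2 A m p r; apply: List.Forall_elt.
- by move=> k Gamma m p r _; apply: entails_intro; apply: TP_top.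
- move=> k Gamma A _ /forced_by_impI IH m p r hGamma.
  by apply: stable_forces; apply: IH.
- by move=> k Gamma A B _ IA _ IB m p r hGamma; split; [apply: IA|apply: IB].
- by move=> k Gamma A B _ IH m p r /IH [].
- by move=> k Gamma A B _ IH m p r /IH [].
- move=> k Gamma A B _ IA m p r /IA.
  exact/semOr_intro_l/persistent_forces.
- move=> k Gamma A B _ IB m p r /IB.
  exact/semOr_intro_r/persistent_forces.
- move=> k Gamma A B C _ IO _ /forced_by_impI IA _ /forced_by_impI IB m p r hGamma.
  apply: semOr_elim (@stable_forces _ C) (IO _ _ _ hGamma) _ _.
    exact: IA.
  exact: IB.
- by move=> k Gamma A B _; apply: forced_by_impI.
- move=> k Gamma A B _ IAB _ IA m p r h.
  exact: semImp_apply (IAB _ _ _ h) (IA _ _ _ h).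
- by move=> k Gamma A _; apply: forced_by_allI.
- by move=> k Gamma A t _ IH m p r /IH hA; apply/forces_inst; apply: semAll_apply hA.
- move=> k Gamma A t _ IH m p r /IH /forces_inst.
  exact/semEx_intro/persistent_forces.
- move=> k Gamma A B _ IE _ /forced_by_impI/forced_by_allI IB m p r hGamma.
  apply: semEx_elim (@stable_forces _ B) (IE _ _ _ hGamma) _.
  by have := IB _ _ _ hGamma; rewrite /= forces_fsubst.
- by move=> k Gamma t m p r _; apply: entails_intro; apply: CEq_refl.
- by move=> k Gamma s t A _ IE _ IA m p r h; apply: forces_eq (IE _ _ _ h) (IA _ _ _ h).
Qed.

(** * Forcing coherent and Sigma1 formulas *)

Lemma semAnd_atom k (A B : cform k) :
  semAnd (semAtom A) (semAtom B) = semAtom (CAnd A B).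
Proof. by apply: sem_eq => m p r; rewrite /semAtom entails_and. Qed.

Lemma semOr_atom k (A B : cform k) :
  semOr (semAtom A) (semAtom B) = semAtom (COr A B).
Proof.
rewrite -[RHS]semNot_semNot; last exact: regular_atom.
congr semNot; apply: sem_eq => m p r.
by rewrite /semAnd !semNot_atomP inconsistent_assume_or.
Qed.

Lemma semEx_atom k (A : cform k.+1) : semEx (semAtom A) = semAtom (CEx A).
Proof.
rewrite -[RHS]semNot_semNot; last exact: regular_atom.
congr semNot; apply: sem_eq => m p r.
rewrite semAllP; last exact: persistent_imp.
by rewrite !semNot_atomP inconsistent_assume_ex.
Qed.

Lemma semBAll_atom k t (A : cform k.+1) :
  semAll (semImp (semAtom (CLt (Var ord0) (tsubst (@shift k) t))) (semAtom A)) =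
  semAtom (CBAll t A).
Proof.
apply: sem_eq => m p r; rewrite semAllP; last exact: persistent_imp.
rewrite semImp_atomP; last exact: regular_atom.
by rewrite /semAtom /= entails_ball upE !substE.
Qed.

Lemma semImp_atom k (A B C : cform k) :
  complement A C -> semImp (semAtom A) (semAtom B) = semAtom (COr C B).
Proof.
move=> /complement_csubst AC; apply: sem_eq => m p r.
rewrite semImp_atomP; last exact: regular_atom.
exact: entails_assume_complement.
Qed.

Lemma forces_embed k (A : cform k) : forces (embed A) = semAtom A.
Proof.
elim: A => {k} //=.
- exact: semBot_atom.
- by move=> k A -> B ->; apply: semAnd_atom.
- by move=> k A -> B ->; apply: semOr_atom.
- by move=> k A ->; apply: semEx_atom.
- by move=> k t A ->; apply: semBAll_atom.
Qed.

Lemma delta0_coherent k (A : fform k) : delta0 A ->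
  exists B C : cform k, forces A = semAtom B /\ complement B C.
Proof.
elim=> {k A}.
- move=> k s t; exists (CEq s t), (COr (CLt s t) (CLt t s)); split=> //.
  exact: complement_eq.
- move=> k s t; exists (CLt s t), (CLe t s); split=> //.
  exact: complement_lt.
- by move=> k; exists CTop, CBot; split=> //; apply: complement_top.
- move=> k; exists CBot, CTop; split; first exact: semBot_atom.
  exact/complement_sym/complement_top.
- move=> k A A' _ [B [C [eA BC]]] _ [B' [C' [eA' BC']]].
  exists (CAnd B B'), (COr C C'); split; first by rewrite /= eA eA' semAnd_atom.
  exact: complement_and.
- move=> k A A' _ [B [C [eA BC]]] _ [B' [C' [eA' BC']]].
  exists (COr B B'), (CAnd C C'); split; first by rewrite /= eA eA' semOr_atom.
  exact: complement_or.
- move=> k A A' _ [B [C [eA BC]]] _ [B' [C' [eA' BC']]].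
  exists (COr C B'), (CAnd B C'); split.
    by rewrite /= eA eA' (semImp_atom _ BC).
  exact: complement_or (complement_sym BC) BC'.
- move=> k t A _ [B [C [eA BC]]].
  exists (CBAll t B), (CEx (CAnd (CLt (Var ord0) (tsubst (@shift k) t)) C)); split.
    by rewrite /= eA semBAll_atom.
  exact: complement_ball.
- move=> k t A _ [B [C [eA BC]]].
  exists (CEx (CAnd (CLt (Var ord0) (tsubst (@shift k) t)) B)), (CBAll t C); split.
    by rewrite /= eA semAnd_atom semEx_atom.
  exact/complement_sym/complement_ball/complement_sym.
Qed.

Lemma sigma1_coherent k (A : fform k) :
  sigma1 A -> exists B : cform k, forces A = semAtom B.
Proof.
elim=> {k A} [k A /delta0_coherent [B [_ [-> _]]]|k A _ [B eA]]; first by exists B.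
by exists (CEx B); rewrite /= eA semEx_atom.
Qed.

(** * Validity of the axioms *)

Lemma valid_univ_closure k (A : fform k) : valid (univ_closure A) <-> valid A.
Proof.
elim: k A => [//|k IH] A /=; rewrite IH; split=> vA m p r.
  by have := semAll_apply (r ord0) (vA m p (@shift k >> r)); rewrite scons_eta.
by move=> l s q pq t; apply: vA.
Qed.

Lemma valid_embed k (A : cform k) : CTop |-- A -> valid (embed A).
Proof.
move=> hA m p r; rewrite forces_embed; apply: entails_intro.
exact: TP_cut (TP_top _) (TP_subst r hA).
Qed.

Lemma valid_imp_embed k (A B : cform k) :
  valid (FImp (embed A) (embed B)) <-> A |-- B.
Proof.
rewrite /valid /= !forces_embed; split=> [h|hAB m p r].
  have := h k (Condition CTop CBot) (@Var k).
  rewrite semImp_atomP; last exact: regular_atom.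
  rewrite /semAtom !csubst_Var => /(TP_cut (TP_and (TP_top _) (TP_id _))) hAB.
  by apply: TP_cut hAB (TP_or (TP_id _) (TP_bot _)).
rewrite semImp_atomP; last exact: regular_atom.
exact: entails_mono (TP_subst r hAB) (entails_assume _ _).
Qed.

Lemma valid_induction k (A : fform k.+1) : sigma1 A ->
  valid (FImp (FAnd (fsubst (inst Zero) A) (FAll (FImp A (fsubst (@succ_inst k) A))))
              (FAll A)).
Proof.
case/sigma1_coherent=> B eA; rewrite /valid /= !forces_fsubst eA !reindex_atom.
move=> m0 _ r0 m s p _; move: (r0 >> s) => r [].
rewrite !semAllP; try exact: persistent_imp; try exact: persistent_atom.
rewrite semImp_atomP; last exact: regular_atom.
rewrite /semAtom => h0 hS; apply: entails_induction.
  by move: h0; simpl_subst.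
by move: hS; simpl_subst.
Qed.

Lemma ISigma1_valid (A : fform 0) : ISigma1 A -> valid A.
Proof.
case=> {A} [|x y|x|x y|x|x y|k s t st|x y|k A hA]; apply/valid_univ_closure.
- exact/(@valid_imp_embed _ (CEq _ _) CBot)/Succ_neq0/TP_id.
- exact/(@valid_imp_embed _ (CEq _ _) (CEq _ _))/Succ_inj/TP_id.
- exact/(@valid_embed _ (CEq _ _))/Add_Zero.
- exact/(@valid_embed _ (CEq _ _))/Add_Succ.
- exact/(@valid_embed _ (CEq _ _))/Mul_Zero.
- exact/(@valid_embed _ (CEq _ _))/Mul_Succ.
- exact/(@valid_embed _ (CEq _ _))/TP_ax/T_def.
- move=> m p r; split.
    exact: ((valid_imp_embed _ _).2 (TP_ax T_lt_ex)).
  exact: ((valid_imp_embed _ _).2 (TP_ax T_ex_lt)).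
- exact: valid_induction.
Qed.

Theorem theorem6p1 (n : nat) (phi psi : cform n) :
  ISigma1_proves phi psi -> T_proves phi psi.
Proof.
move=> /(soundness ISigma1_valid) forced.
apply/valid_imp_embed/valid_univ_closure => m p r.
by apply: forced; apply: List.Forall_nil.
Qed.
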